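(* For every integer $n\ge 1$, we have $\overline{\rho}_n(\check{\mathfrak{H}}^1)\subset\ker\overline{Z}$.
   Context: Let $\mathfrak{H}=\mathbb{Q}\langle x,y\rangle$ be the non-commutative polynomial algebra over $\mathbb{Q}$ in two indeterminates $x,y$. Let $\mathfrak{H}^1=\mathbb{Q}+\mathfrak{H}y$ and $\mathfrak{H}^0=\mathbb{Q}+x\mathfrak{H}y$. Let $\check{\mathfrak{H}}^1$ be the $\mathbb{Q}$-subspace of $\mathfrak{H}^1$ spanned by all words (monomials in $x,y$) of $\mathfrak{H}^1$ other than powers of $y$ (with $1=y^0$ counted as a power of $y$). For integers $k_1>1$, $k_2,\ldots,k_m\ge 1$, the multiple zeta-star value is $\zeta^{\star}(k_1,\ldots,k_m)=\sum_{m_1\ge m_2\ge\cdots\ge m_m>0}\frac{1}{m_1^{k_1}\cdots m_m^{k_m}}$. The $\mathbb{Q}$-linear map $\overline{Z}\colon\mathfrak{H}^0\to\mathbb{R}$ is defined by $\overline{Z}(1)=1$ and $\overline{Z}(x^{k_1-1}yx^{k_2-1}y\cdots x^{k_m-1}y)=\zeta^{\star}(k_1,k_2,\ldots,k_m)$. Let $\gamma$ be the algebra automorphism of $\mathfrak{H}$ with $\gamma(x)=x$, $\gamma(y)=x+y$; thus $\gamma^{-1}(x)=x$, $\gamma^{-1}(y)=y-x$. For $n\ge 1$, $\mathfrak{H}$ acts on $\mathfrak{H}^{\otimes(n+1)}$ on the left and right by $a\diamond(w_1\otimes\cdots\otimes w_{n+1})=w_1\otimes\cdots\otimes w_n\otimes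 aw_{n+1}$ and $(w_1\otimes\cdots\otimes w_{n+1})\diamond b=w_1b\otimes w_2\otimes\cdots\otimes w_{n+1}$. The $\mathbb{Q}$-linear map $\overline{\mathcal{C}}_n\colon\mathfrak{H}\to\mathfrak{H}^{\otimes(n+1)}$ is determined by $\overline{\mathcal{C}}_n(x)=x\otimes y^{\otimes n}$, $\overline{\mathcal{C}}_n(y)=-(x\otimes y^{\otimes n})$ and $\overline{\mathcal{C}}_n(ww')=\overline{\mathcal{C}}_n(w)\diamond\gamma^{-1}(w')+\gamma^{-1}(w)\diamond\overline{\mathcal{C}}_n(w')$ for all $w,w'\in\mathfrak{H}$ (so $\overline{\mathcal{C}}_n(1)=0$). Let $M_n\colon\mathfrak{H}^{\otimes(n+1)}\to\mathfrak{H}$ be the multiplication map $w_1\otimes\cdots\otimes w_{n+1}\mapsto w_1\cdots w_{n+1}$, and set $\overline{\rho}_n=M_n\overline{\mathcal{C}}_n$; its image lies in $x\mathfrak{H}y$. *)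

(* Defs.v *)
From HB Require Import structures.
From mathcomp Require Import all_boot all_order all_algebra finmap.
From mathcomp.multinomials Require Import monalg.
From mathcomp Require Import classical_sets reals ereal esum.

Set Implicit Arguments.
Unset Strict Implicit.
Unset Printing Implicit Defensive.

Import GRing.Theory.
Local Open Scope classical_set_scope.
Local Open Scope ring_scope.

(* The letters x and y are encoded by [false] and [true]. *)
Definition letter := bool.
Definition lx : letter := false.
Definition ly : letter := true.

Notation word := {fmonom letter}.

(* The monoid algebra of the free monoid on {x, y}, that is Q<x, y>. *)
Notation H := {malg rat[word]}.

Definition gen (c : letter) : H := << fmu c >>.
Definition X : H := gen lx.
Definition Y : H := gen ly.

(* H^{(x)n+1}, as the Q-vector space with basis the pure tensors of words
   w_1 (x) ... (x) w_{n+1}, represented by the tuples (w_1, ..., w_{n+1}). *)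
Notation Htensor n := {malg rat[n.+1.-tuple word]}.

(* The Q-linear extension of a map defined on a basis. *)
Definition lin_ext (K : choiceType) (V : lmodType rat) (f : K -> V)
    (g : {malg rat[K]}) : V :=
  \sum_(k <- msupp g) g@_k *: f k.

Section LinExt.
Variables (K : choiceType) (V : lmodType rat).
Implicit Types (f : K -> V) (g : {malg rat[K]}).

Lemma lin_extEw f (d : {fset K}) g : (msupp g `<=` d)%fset ->
  lin_ext f g = \sum_(k <- d) g@_k *: f k.
Proof.
move=> le; rewrite /lin_ext (big_fset_incl _ le) => //= k _ /mcoeff_outdom ->.
by rewrite scale0r.
Qed.

Lemma lin_extU f k : lin_ext f << k >> = f k.
Proof. by rewrite (lin_extEw f msuppU_le) big_seq_fset1 mcoeffUU scale1r. Qed.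

Lemma lin_ext_is_linear f : linear (lin_ext f).
Proof.
move=> c g1 g2; pose d := (msupp g1 `|` msupp g2)%fset.
have le1 : (msupp g1 `<=` d)%fset by exact: fsubsetUl.
have le2 : (msupp g2 `<=` d)%fset by exact: fsubsetUr.
have le : (msupp (c *: g1 + g2) `<=` d)%fset.
  apply: (fsubset_trans (msuppD_le _ _)); apply: fsetUSS; last by [].
  exact: msuppZ_le.
rewrite (lin_extEw f le) (lin_extEw f le1) (lin_extEw f le2).
rewrite scaler_sumr -big_split; apply: eq_bigr => k _.
by rewrite mcoeffD mcoeffZ scalerDl scalerA.
Qed.

HB.instance Definition _ f :=
  GRing.isLinear.Build rat {malg rat[K]} V *:%R (lin_ext f)
    (lin_ext_is_linear f).

Lemma malg_basis_ind (P : {malg rat[K]} -> Prop) :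
  (forall c g1 g2, P g1 -> P g2 -> P (c *: g1 + g2)) ->
  P 0 -> (forall k, P << k >>) -> forall g, P g.
Proof.
move=> PD P0 PU g; rewrite (monalgE g).
elim: (msupp g : seq K) => [|k s IH]; first by rewrite big_nil.
rewrite big_cons; have -> : << g@_k *g k >> = g@_k *: << k >> :> {malg rat[K]}.
  by apply/malgP => k'; rewrite mcoeffZ !mcoeffU mulr_natr.
exact: PD.
Qed.

End LinExt.

(* The algebra endomorphism of H with x |-> u and y |-> v, see [substM]. *)
Definition subst (u v : H) : H -> H :=
  lin_ext (fun w : word => \prod_(c <- w) (if c == lx then u else v)).

Definition gamma : H -> H := subst X (X + Y).
(* The inverse of [gamma], see [gammaK] and [gammaVK]. *)
Definition gammaV : H -> H := subst X (Y - X).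

(* a <> (w_1 (x) ... (x) w_{n+1}) = w_1 (x) ... (x) w_n (x) a w_{n+1} *)
Definition ldiam n (a : H) (t : Htensor n) : Htensor n :=
  lin_ext (fun u : word =>
    lin_ext (fun W : n.+1.-tuple word =>
      << [tuple if i == ord_max then mmul u (tnth W i) else tnth W i
           | i < n.+1] >> : Htensor n) t) a.

(* (w_1 (x) ... (x) w_{n+1}) <> b = w_1 b (x) w_2 (x) ... (x) w_{n+1} *)
Definition rdiam n (t : Htensor n) (b : H) : Htensor n :=
  lin_ext (fun u : word =>
    lin_ext (fun W : n.+1.-tuple word =>
      << [tuple if i == ord0 then mmul (tnth W i) u else tnth W i
           | i < n.+1] >> : Htensor n) t) b.

Definition xyn n : Htensor n := << [tuple of fmu lx :: nseq n (fmu ly)] >>.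

Definition Cbar_letter n (c : letter) : Htensor n :=
  if c == lx then xyn n else - xyn n.

Fixpoint Cbar_seq n (s : seq letter) : Htensor n :=
  if s is c :: s' then
    rdiam (Cbar_letter n c) (gammaV << FMonom s' >>)
    + ldiam (gammaV (gen c)) (Cbar_seq n s')
  else 0.

(* Characterized by [Cbar_X], [Cbar_Y] and [Cbar_Leibniz] below. *)
Definition Cbar n : H -> Htensor n := lin_ext (fun w : word => Cbar_seq n w).

Definition Mmul n : Htensor n -> H :=
  lin_ext (fun W : n.+1.-tuple word => \prod_(w <- W) (<< w >> : H)).

Definition rhobar n (h : H) : H := Mmul (Cbar n h).

Definition H0 : set H :=
  [set h | exists (c : rat) (g : H), h = c%:A + X * g * Y].
Definition H1 : set H := [set h | exists (c : rat) (g : H), h = c%:A + g * Y].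

Definition Qspan (V : lmodType rat) (S : set V) : set V :=
  [set v | exists s : seq (rat * V),
     (forall p, p \in s -> S p.2) /\ v = \sum_(p <- s) p.1 *: p.2].

Definition H1check : set H :=
  Qspan [set h | exists w : word,
    [/\ h = << w >>, H1 h & forall k : nat, h <> Y ^+ k]].

(* zeta^*(k_1, ..., k_m), the sum of a family of nonnegative terms; [fine]
   returns 0 when it diverges.  The empty index gives 1. *)
Definition zeta_star (R : realType) (k : seq nat) : R :=
  fine (\esum_(m in [set m : (size k).-tuple nat |
                       sorted geq m && all (fun i => 0 < i)%N m])
          (\prod_(i < size k) ((tnth m i)%:R ^+ nth 0%N k i)^-1 : R)%:E).

Definition word_of_index (k : seq nat) : seq letter :=
  flatten [seq rcons (nseq a.-1 lx) ly | a <- k].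

(* The inverse of [word_of_index]; [a] counts the letters x read since the last
   letter y.  Trailing letters x are ignored (no word of H0 has any). *)
Fixpoint index_of_word (a : nat) (s : seq letter) : seq nat :=
  if s is c :: s' then
    if c == lx then index_of_word a.+1 s' else a.+1 :: index_of_word 0 s'
  else [::].

(* The map is meant on H0 only: on other words its value is arbitrary, and
   [kerZbar] requires membership in H0. *)
Definition Zbar (R : realType) (h : H) : R :=
  mmap (@ratr R) (fun w : word => zeta_star R (index_of_word 0 w)) h.

Definition kerZbar (R : realType) : set H :=
  [set h | H0 h /\ Zbar R h = 0].

Lemma word_of_indexK (k : seq nat) : all (fun a => 0 < a)%N k ->
  index_of_word 0 (word_of_index k) = k.
Proof.
have aux b a s : index_of_word b (nseq a lx ++ s) = index_of_word (b + a) s.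
  elim: a b => [|a IH] b /=; first by rewrite addn0.
  by rewrite IH addSnnS.
elim: k => //= a k IH /andP[a0 /IH {}IH].
by rewrite /word_of_index /= cat_rcons aux /= -/(word_of_index k) IH prednK.
Qed.

Lemma Zbar_word (R : realType) (k : seq nat) : all (fun a => 0 < a)%N k ->
  Zbar R << FMonom (word_of_index k) >> = zeta_star R k.
Proof.
move=> k0; rewrite /Zbar mmapE msuppU oner_eq0 big_seq_fset1 mcoeffUU.
by rewrite rmorph1 mul1r word_of_indexK.
Qed.

Lemma mulUU (u v : word) : << u >> * << v >> = << mmul u v >> :> H.
Proof. by rewrite malgM_def fgmulUU mulr1. Qed.

Lemma substU u v (w : word) :
  subst u v << w >> = \prod_(c <- w) (if c == lx then u else v).
Proof. exact: lin_extU. Qed.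

Lemma subst_linear u v : linear (subst u v).
Proof. exact: lin_ext_is_linear. Qed.

Lemma subst1 u v : subst u v 1 = 1.
Proof. by rewrite substU fm1 big_nil. Qed.

Lemma lin0 (U V : lmodType rat) (f : U -> V) : linear f -> f 0 = 0.
Proof. by move=> fl; have := fl (-1) 0 0; rewrite scaler0 addr0 scaleN1r addNr. Qed.

Lemma linD (U V : lmodType rat) (f : U -> V) : linear f -> {morph f : a b / a + b}.
Proof. by move=> fl a b; rewrite -[a]scale1r fl !scale1r. Qed.

Lemma malg_scaleAr (c : rat) (g h : H) : g * (c *: h) = c *: (g * h).
Proof.
rewrite (malgMEw (fsubset_refl _) (msuppZ_le c h)) (malgME g h).
rewrite scaler_sumr; apply: eq_bigr => u _.
rewrite scaler_sumr; apply: eq_bigr => v _; apply/malgP => w.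
apply: (etrans (mcoeffU _ _ w)); apply: esym; apply: (etrans (mcoeffZ c _ w)).
apply: (etrans (congr1 ( *%R c) (mcoeffU _ _ w))); rewrite mulrnAr mulrCA.
exact: (congr1 (fun a => (g@_u * a) *+ _) (esym (mcoeffZ c h v))).
Qed.

Lemma substM u v : {morph subst u v : g h / g * h}.
Proof.
have e0 := lin0 (subst_linear u v).
move=> g h; elim/malg_basis_ind: g => [c g1 g2 IH1 IH2||w].
- rewrite mulrDl -scalerAl (subst_linear _ _ c (g1 * h)).
  apply: (etrans (congr2 (fun a b => c *: a + b) IH1 IH2)).
  rewrite scalerAl -mulrDl.
  exact: (congr1 ( *%R^~ _) (esym (subst_linear u v c g1 g2))).
- by rewrite mul0r e0 mul0r.
elim/malg_basis_ind: h => [c g1 g2 IH1 IH2||w'].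
- rewrite mulrDr malg_scaleAr (subst_linear _ _ c (_ * g1)).
  apply: (etrans (congr2 (fun a b => c *: a + b) IH1 IH2)).
  rewrite -malg_scaleAr -mulrDr.
  exact: (congr1 ( *%R _) (esym (subst_linear u v c g1 g2))).
- by rewrite mulr0 e0 mulr0.
by rewrite mulUU !substU fmM big_cat.
Qed.

Lemma subst_gen u v c : subst u v (gen c) = if c == lx then u else v.
Proof. by rewrite substU fmU big_seq1. Qed.

Lemma word_prod (w : word) : << w >> = \prod_(c <- w) gen c :> H.
Proof.
case: w => s; elim: s => [|c s IH] /=.
  rewrite big_nil; have -> : FMonom [::] = mone :> word by apply/eqP; rewrite fmP fm1.
  by [].
rewrite big_cons -IH mulUU; congr (<< _ >>).
by apply/eqP; rewrite fmP fmM fmU.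
Qed.

Lemma subst_comp_id u v u' v' :
  subst u v u' = X -> subst u v v' = Y -> cancel (subst u' v') (subst u v).
Proof.
move=> eX eY; elim/malg_basis_ind => [c g1 g2 IH1 IH2||w].
- apply: (etrans (congr1 _ (subst_linear u' v' c g1 g2))).
  apply: (etrans (subst_linear u v c _ _)).
  exact: (congr2 (fun a b => c *: a + b) IH1 IH2).
- by rewrite (lin0 (subst_linear u' v')) (lin0 (subst_linear u v)).
rewrite substU word_prod (big_morph _ (substM u v) (subst1 u v)).
by apply: eq_bigr => -[].
Qed.

Lemma gammaK : cancel gamma gammaV.
Proof.
apply: subst_comp_id; first exact: subst_gen.
by rewrite (linD (subst_linear _ _)) !subst_gen /= addrC subrK.
Qed.

Lemma gammaVK : cancel gammaV gamma.
Proof.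
apply: subst_comp_id; first exact: subst_gen.
rewrite [Y - X]addrC -scaleN1r subst_linear !subst_gen /=.
by rewrite scaleN1r addrA addNr add0r.
Qed.

Lemma ldiamU n (u : word) (W : n.+1.-tuple word) :
  ldiam << u >> << W >> =
  << [tuple if i == ord_max then mmul u (tnth W i) else tnth W i
        | i < n.+1] >>.
Proof. by rewrite /ldiam !lin_extU. Qed.

Lemma rdiamU n (u : word) (W : n.+1.-tuple word) :
  rdiam << W >> << u >> =
  << [tuple if i == ord0 then mmul (tnth W i) u else tnth W i
        | i < n.+1] >>.
Proof. by rewrite /rdiam !lin_extU. Qed.

Lemma ldiam_linearl n (t : Htensor n) : linear (@ldiam n ^~ t).
Proof. exact: lin_ext_is_linear. Qed.

Lemma lin_ext_fun_linear (K : choiceType) (U V : lmodType rat)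
    (f : U -> K -> V) (g : {malg rat[K]}) :
  (forall k, linear (f ^~ k)) -> linear (fun t => lin_ext (f t) g).
Proof.
move=> fl c t1 t2; rewrite /lin_ext scaler_sumr -big_split.
by apply: eq_bigr => k _; rewrite /= fl scalerDr !scalerA mulrC.
Qed.

Lemma ldiam_linearr n (a : H) : linear (@ldiam n a).
Proof. by apply: lin_ext_fun_linear => u; exact: lin_ext_is_linear. Qed.

Lemma rdiam_linearl n (b : H) : linear (@rdiam n ^~ b).
Proof. by apply: lin_ext_fun_linear => u; exact: lin_ext_is_linear. Qed.

Lemma rdiam_linearr n (t : Htensor n) : linear (@rdiam n t).
Proof. exact: lin_ext_is_linear. Qed.

Lemma linear_eq (K : choiceType) (V : lmodType rat) (f g : {malg rat[K]} -> V) :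
  linear f -> linear g -> (forall k, f << k >> = g << k >>) -> f =1 g.
Proof.
move=> fl gl fg; elim/malg_basis_ind => [c g1 g2 IH1 IH2||k //].
- by rewrite fl gl IH1 IH2.
- by rewrite (lin0 fl) (lin0 gl).
Qed.

Lemma ldiamM n (a b : H) (t : Htensor n) :
  ldiam (a * b) t = ldiam a (ldiam b t).
Proof.
move: a; apply: linear_eq => [c a a'|c a a'|u].
- by rewrite mulrDl -scalerAl ldiam_linearl.
- by rewrite ldiam_linearl.
move: b; apply: linear_eq => [c b b'|c b b'|v].
- by rewrite mulrDr malg_scaleAr ldiam_linearl.
- by rewrite ldiam_linearl ldiam_linearr.
move: t; apply: linear_eq => [c t t'|c t t'|W].
- by rewrite ldiam_linearr.
- by rewrite !ldiam_linearr.
rewrite mulUU !ldiamU; congr (<< _ >>); apply: eq_from_tnth => i.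
by rewrite !tnth_mktuple; case: eqP => // _; rewrite mulmA.
Qed.

Lemma rdiamM n (t : Htensor n) (a b : H) :
  rdiam t (a * b) = rdiam (rdiam t a) b.
Proof.
move: a; apply: linear_eq => [c a a'|c a a'|u].
- by rewrite mulrDl -scalerAl rdiam_linearr.
- by rewrite rdiam_linearr rdiam_linearl.
move: b; apply: linear_eq => [c b b'|c b b'|v].
- by rewrite mulrDr malg_scaleAr rdiam_linearr.
- by rewrite rdiam_linearr.
move: t; apply: linear_eq => [c t t'|c t t'|W].
- by rewrite rdiam_linearl.
- by rewrite !rdiam_linearl.
rewrite mulUU !rdiamU; congr (<< _ >>); apply: eq_from_tnth => i.
by rewrite !tnth_mktuple; case: eqP => // _; rewrite mulmA.
Qed.

Lemma lrdiam n (a : H) (t : Htensor n) (b : H) :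
  ldiam a (rdiam t b) = rdiam (ldiam a t) b.
Proof.
move: a; apply: linear_eq => [c a a'|c a a'|u].
- by rewrite ldiam_linearl.
- by rewrite ldiam_linearl rdiam_linearl.
move: b; apply: linear_eq => [c b b'|c b b'|v].
- by rewrite rdiam_linearr ldiam_linearr.
- by rewrite rdiam_linearr.
move: t; apply: linear_eq => [c t t'|c t t'|W].
- by rewrite rdiam_linearl ldiam_linearr.
- by rewrite ldiam_linearr rdiam_linearl.
rewrite rdiamU !ldiamU rdiamU; congr (<< _ >>); apply: eq_from_tnth => i.
rewrite !tnth_mktuple; case: (i == ord_max); case: (i == ord0) => //.
by rewrite mulmA.
Qed.

Lemma ldiam1 n (t : Htensor n) : ldiam 1 t = t.
Proof.
move: t; apply: linear_eq => // [|W]; first exact: ldiam_linearr.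
rewrite ldiamU; congr (<< _ >>); apply: eq_from_tnth => i.
by rewrite !tnth_mktuple mul1m if_same.
Qed.

Lemma rdiam1 n (t : Htensor n) : rdiam t 1 = t.
Proof.
move: t; apply: linear_eq => // [|W]; first exact: rdiam_linearl.
rewrite rdiamU; congr (<< _ >>); apply: eq_from_tnth => i.
by rewrite !tnth_mktuple mulm1 if_same.
Qed.

Lemma Cbar_linear n : linear (@Cbar n).
Proof. exact: lin_ext_is_linear. Qed.

Lemma gammaV_linear : linear gammaV.
Proof. exact: subst_linear. Qed.

Lemma gammaV1 : gammaV 1 = 1.
Proof. exact: subst1. Qed.

Lemma gammaVM : {morph gammaV : g h / g * h}.
Proof. exact: substM. Qed.

Lemma Cbar1 n : Cbar n 1 = 0.
Proof. by rewrite /Cbar lin_extU fm1. Qed.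

Lemma Cbar_cons n c (s : seq letter) :
  Cbar n (gen c * << FMonom s >>) =
  rdiam (Cbar_letter n c) (gammaV << FMonom s >>)
  + ldiam (gammaV (gen c)) (Cbar n << FMonom s >>).
Proof. by rewrite mulUU /Cbar !lin_extU fmM fmU. Qed.

Lemma Cbar_gen_mul n c (h : H) :
  Cbar n (gen c * h) =
  rdiam (Cbar_letter n c) (gammaV h) + ldiam (gammaV (gen c)) (Cbar n h).
Proof.
move: h; apply: linear_eq => [d h h'|d h h'|[s]].
- by rewrite mulrDr malg_scaleAr Cbar_linear.
- rewrite Cbar_linear gammaV_linear rdiam_linearr ldiam_linearr scalerDr.
  by rewrite addrACA.
exact: Cbar_cons.
Qed.

Lemma FMonom0 : << FMonom [::] >> = 1 :> H.
Proof. by rewrite word_prod big_nil. Qed.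

Lemma FMonom_cons c (s : seq letter) :
  << FMonom (c :: s) >> = gen c * << FMonom s >> :> H.
Proof. by rewrite !word_prod big_cons. Qed.

Lemma Cbar_gen n c : Cbar n (gen c) = Cbar_letter n c.
Proof.
rewrite -[gen c]mulr1 -FMonom0 Cbar_cons FMonom0 gammaV1 Cbar1 rdiam1.
by rewrite (lin0 (ldiam_linearr _)) addr0.
Qed.

Lemma Cbar_X n : Cbar n X = xyn n.
Proof. exact: Cbar_gen. Qed.

Lemma Cbar_Y n : Cbar n Y = - xyn n.
Proof. exact: Cbar_gen. Qed.

Lemma Leibniz_aux n (A B C : Htensor n) (a g h : H) :
  rdiam A (g * h) + ldiam a (rdiam B h + ldiam g C) =
  rdiam (rdiam A g + ldiam a B) h + ldiam (a * g) C.
Proof.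
have E1 := linD (rdiam_linearl h) (rdiam A g) (ldiam a B).
have E2 := linD (ldiam_linearr a) (rdiam B h) (ldiam g C).
apply: (etrans (congr2 +%R (rdiamM A g h) E2)).
apply: esym; apply: (etrans (congr2 +%R E1 (ldiamM a g C))).
apply: (etrans (esym (addrA (rdiam (rdiam A g) h) (rdiam (ldiam a B) h)
  (ldiam a (ldiam g C))))).
exact: (congr1 (fun P => rdiam (rdiam A g) h + (P + ldiam a (ldiam g C)))
  (esym (lrdiam a B h))).
Qed.

Lemma Cbar_Leibniz n (w w' : H) :
  Cbar n (w * w') =
  rdiam (Cbar n w) (gammaV w') + ldiam (gammaV w) (Cbar n w').
Proof.
move: w; apply: linear_eq => [c a a'|c a a'|[s]].
- by rewrite mulrDl -scalerAl Cbar_linear.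
- rewrite Cbar_linear rdiam_linearl gammaV_linear ldiam_linearl scalerDr.
  by rewrite addrACA.
move: w'; apply: linear_eq => [c b b'|c b b'|[s']].
- by rewrite mulrDr malg_scaleAr Cbar_linear.
- rewrite Cbar_linear gammaV_linear rdiam_linearr ldiam_linearr scalerDr.
  by rewrite addrACA.
elim: s => [|c s IH].
  rewrite FMonom0 mul1r Cbar1 gammaV1 ldiam1 (lin0 (rdiam_linearl _)).
  by rewrite add0r.
rewrite FMonom_cons; move: << FMonom s >> << FMonom s' >> IH => g h IH.
rewrite -mulrA; apply: (etrans (Cbar_gen_mul n c (g * h))).
apply: (etrans (congr2 (fun P Q => rdiam (Cbar_letter n c) P
  + ldiam (gammaV (gen c)) Q) (gammaVM g h) IH)).
apply: (etrans _ (esym (congr2 (fun P Q => rdiam P (gammaV h)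
  + ldiam Q (Cbar n h)) (Cbar_gen_mul n c g) (gammaVM (gen c) g)))).
exact: Leibniz_aux.
Qed.

(* Main.v *)
(* Letting x and y act on the Taylor coefficients of a power series f by
   integration of f dt/t and f dt/(1 - t) turns them into the lower triangular
   matrices X = diag(1/k) and Y = ([m < k]/k)_{k,m}.  With S = X + Y, zeta-star
   values are obtained by letting x act as X and y as S, so that gamma^-1(y)
   acts as Y.  The partial sums of the zeta-star values of rhobar_n(w) are thus
   signed sums of tr(P L), where P = (1/(m k))_{m,k} and where L runs over the
   words obtained from the cyclic word w S^(n-1) by removing a letter of w and
   cutting there; the sign is + for a letter x and - for a letter y.

   The strictly upper triangular matrix Q = ([m < k]/(k - m))_{m,k} satisfies
   X Q - Q X = P and Q Y - Y Q = P above the diagonal, the second identity also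
   on the diagonal.  Hence tr(P L) is, up to the sign, the difference of
   tr(Q L c) and tr(Q c L) for the removed letter c, while moving a letter S
   around does not change tr(Q _).  Summing over all the rotations of w S^(n-1),
   everything cancels.  Truncating the matrices at size N perturbs the identity
   for Y by an error term, bounded by a power of log N divided by N when L
   contains a letter X. *)
Require Import Defs.
From mathcomp Require Import all_boot all_order all_algebra finmap.
From mathcomp.multinomials Require Import monalg.
From mathcomp Require Import boolp classical_sets functions cardinality fsbigop.
From mathcomp Require Import reals ereal normedtype sequences esum realfun.
From mathcomp Require Import zify ring lra.

Set Implicit Arguments.
Unset Strict Implicit.
Unset Printing Implicit Defensive.

Import Order.TTheory GRing.Theory Num.Theory numFieldNormedType.Exports.
Local Open Scope classical_set_scope.
Local Open Scope ring_scope.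

(** * Multiplying out the tensors *)

Lemma linear_mul2 (p q : H) : linear (fun h : H => p * h * q).
Proof. by move=> c g h; rewrite mulrDr malg_scaleAr mulrDl -scalerAl. Qed.

Lemma linear_mul3 (p q r : H) : linear (fun h : H => p * (q * h * r)).
Proof.
move=> c g h; apply: (etrans (congr1 ( *%R p) (linear_mul2 q r c g h))).
exact: (etrans (mulrDr p _ _) (congr1 (+%R^~ _) (malg_scaleAr c p _))).
Qed.

Lemma Mmul_linear n : linear (@Mmul n).
Proof. exact: lin_ext_is_linear. Qed.

Lemma prod_ly n (f : 'I_n -> word) : (forall i, f i = fmu ly) ->
  \prod_(i < n) << f i >> = Y ^+ n :> H.
Proof.
move=> fE; transitivity (\prod_(i < n) Y); last by rewrite prodr_const card_ord.
by apply: eq_bigr => i _; rewrite fE.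
Qed.

(** The tensor has [n.+2] factors, so the first and the last are distinct: [a] lands just after the
    letter x, and [b] just before the last of the n + 1 letters y. *)
Lemma Mmul_xyn n (a b : H) :
  Mmul (ldiam b (rdiam (xyn n.+1) a)) = X * a * (Y ^+ n * b * Y).
Proof.
move: a; apply: linear_eq => [c a a'|c a a'|u].
- by rewrite rdiam_linearr ldiam_linearr Mmul_linear.
- exact: linear_mul2.
move: b; apply: linear_eq => [c b b'|c b b'|v].
- by rewrite ldiam_linearl Mmul_linear.
- exact: linear_mul3.
have xynS (i : 'I_n.+1) :
    tnth [tuple of fmu lx :: nseq n.+1 (fmu ly)] (lift ord0 i) = fmu ly.
  transitivity (nth (fmu ly) (nseq n.+1 (fmu ly)) i); last first.
    by rewrite nth_nseq if_same.
  by rewrite (tnth_nth (fmu ly)).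
rewrite rdiamU ldiamU /Mmul lin_extU big_tuple big_ord_recl big_ord_recr /=.
have head : tnth [tuple of fmu lx :: nseq n.+1 (fmu ly)] ord0 = fmu lx by [].
rewrite (tnth_mktuple _ ord0) /= tnth_mktuple /= head.
rewrite (tnth_mktuple _ (lift ord0 ord_max)) /= tnth_mktuple /= xynS.
rewrite ifT; last by rewrite -val_eqE.
rewrite prod_ly => [|i]; last first.
  rewrite tnth_mktuple tnth_mktuple /= xynS ifN //.
  by rewrite -val_eqE /= /bump /= add1n eqSS neq_ltn ltn_ord.
exact: (congr2 *%R (esym (mulUU (fmu lx) u))
  (etrans (congr1 ( *%R (Y ^+ n)) (esym (mulUU v (fmu ly)))) (mulrA _ _ _))).
Qed.

(** * Lower triangular matrices acting on coefficient sequences *)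

Section Series.
Variable R : realType.
Implicit Types (A B C L : nat -> nat -> R) (f g : nat -> R).

Definition lower A := forall k m, (k < m)%N -> A k m = 0.

(** Stopping at the diagonal makes this the full matrix-vector product when [A] is lower triangular,
    with no truncation size to carry around. *)
Definition kapp A f (k : nat) : R := \sum_(j < k.+1) A k j * f j.

Definition kcomp A B (k m : nat) : R := kapp A (B ^~ m) k.

Definition kone (k m : nat) : R := (k == m)%:R.

(* [Some lx] and [Some ly] act on the coefficients of a power series f as
   integration of f dt/t and f dt/(1 - t), and [None] acts as their sum.  The
   junk value 0^-1 = 0 makes the row of index 0 vanish. *)
Definition kletter (o : option letter) (k m : nat) : R :=
  (if o is Some c then if c == lx then k == m else m < k else m <= k)%N%:R
  / k%:R.

Definition kword (s : seq (option letter)) : nat -> nat -> R :=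
  foldr (fun o => kcomp (kletter o)) kone s.

Lemma kappE A f k n : lower A -> (k < n)%N ->
  kapp A f k = \sum_(j < n) A k j * f j.
Proof.
move=> lA kn; rewrite /kapp.
rewrite (big_ord_widen n (fun j => A k j * f j) kn) big_mkcond /=.
apply: eq_bigr => j _; rewrite ltnS; case: leqP => // kj.
by rewrite lA // mul0r.
Qed.

Lemma lower_kone : lower kone.
Proof. by move=> k m km; rewrite /kone ltn_eqF. Qed.

Lemma lower_kletter o : lower (kletter o).
Proof.
move=> k m km; rewrite /kletter; case: o => [c|].
  by case: ifP => _; [rewrite ltn_eqF|rewrite ltnNge ltnW]; rewrite ?mul0r.
by rewrite leqNgt km mul0r.
Qed.

Lemma lower_kcomp A B : lower B -> lower (kcomp A B).
Proof.
move=> lB k m km; rewrite /kcomp /kapp big1 // => j _.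
by rewrite lB ?mulr0 //; apply: leq_ltn_trans km; rewrite -ltnS.
Qed.

Lemma lower_kword s : lower (kword s).
Proof.
by elim: s => [|o s IH]; [exact: lower_kone|exact: lower_kcomp].
Qed.

Lemma eq_kapp A f g : f =1 g -> kapp A f =1 kapp A g.
Proof. by move=> fg k; apply: eq_bigr => j _; rewrite fg. Qed.

Lemma kapp_comp A B f : lower B -> kapp (kcomp A B) f =1 kapp A (kapp B f).
Proof.
move=> lB k; rewrite /kapp /kcomp.
transitivity (\sum_(j < k.+1) \sum_(i < k.+1) A k i * (B i j * f j)).
  by apply: eq_bigr => j _; rewrite mulr_suml; apply: eq_bigr => i _;
    rewrite mulrA.
rewrite exchange_big /=; apply: eq_bigr => i _.
by rewrite -/(kapp _ _ _) (@kappE B f i k.+1) // mulr_sumr.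
Qed.

Lemma kapp_kone f : kapp kone f =1 f.
Proof.
move=> k; rewrite /kapp (bigD1 ord_max) //= /kone eqxx mul1r big1 ?addr0 //.
by move=> j /eqP nj; case: eqP => [kj|_]; rewrite ?mul0r //; case: nj;
  apply: val_inj.
Qed.

Lemma kapp_kword s f :
  kapp (kword s) f =1 foldr (fun o => kapp (kletter o)) f s.
Proof.
elim: s => [|o s IH] k /=; first exact: kapp_kone.
by rewrite kapp_comp; [apply: eq_kapp|exact: lower_kword].
Qed.

(** Rotations need the last letter split off, whereas [kword] unfolds from the first. *)
Lemma kword_rcons s o : kword (rcons s o) =2 kcomp (kword s) (kletter o).
Proof.
move=> k m; rewrite /kcomp kapp_kword; elim: s k => [|o' s IH] k /=.
  rewrite /kcomp /kapp (bigD1 (inord m)) //=.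
  have [mk|km] := leqP m k.
    rewrite inordK ?ltnS // /kone eqxx mulr1 big1 ?addr0 // => j nj.
    case: eqP => [jm|]; rewrite ?mulr0 //; case/eqP: nj; apply: val_inj => /=.
    by rewrite inordK ?ltnS.
  rewrite [RHS]lower_kletter // /kone.
  have nj (j : 'I_k.+1) : (val j == m) = false.
    by apply/ltn_eqF/(leq_trans (ltn_ord j)).
  by rewrite nj mulr0 add0r big1 // => j _; rewrite nj mulr0.
by rewrite /kcomp; apply: eq_kapp => j; exact: IH.
Qed.

Lemma kletter_ge0 o k m : 0 <= kletter o k m.
Proof. by rewrite /kletter; case: o => [c|];
  rewrite mulr_ge0 ?invr_ge0 ?ler0n. Qed.

Lemma kletter_None o k m : kletter o k m <= kletter None k m.
Proof.
rewrite /kletter ler_wpM2r ?invr_ge0 ?ler0n // ler_nat.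
by case: o => [c|//]; case: ifP => _; lia.
Qed.

Lemma kapp_ge0 A f k : (forall j, 0 <= A k j) -> (forall j, 0 <= f j) ->
  0 <= kapp A f k.
Proof. by move=> A0 f0; apply: sumr_ge0 => j _; exact: mulr_ge0. Qed.

Lemma kword_ge0 s k m : 0 <= kword s k m.
Proof.
elim: s k m => [|o s IH] k m; first exact: ler0n.
by apply: kapp_ge0 => j //; exact: kletter_ge0.
Qed.

(** Diagonals of lower triangular matrices multiply, and [kletter (Some ly)] has zero diagonal. *)
Lemma kword_diag s k : Some ly \in s -> kword s k k = 0.
Proof.
have diag B : lower B -> forall A, kcomp A B k k = A k k * B k k.
  move=> lB A; rewrite /kcomp /kapp big_ord_recr /= big1 ?add0r // => j _.
  by rewrite lB ?mulr0.
elim: s => // o s IH; rewrite inE /= (diag _ (@lower_kword s)) =>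
  /orP[/eqP<-|/IH->].
  by rewrite /kletter /= ltnn !mul0r.
by rewrite mulr0.
Qed.

(** * Traces and commutators with [kQ] *)

(* [ktr n A L] is the trace of the product of the truncations of A and L. *)
Definition ktr n A L : R := \sum_(k < n) \sum_(m < n) A m k * L k m.

(* [kerr n m k] is the tail, from index n on, of the series for the entry (m, k)
   of the product of [kQ] and [kletter (Some ly)]. *)
Definition kQ (m k : nat) : R := (0 < m < k)%N%:R / (k - m)%:R.
Definition kP (m k : nat) : R := m%:R^-1 / k%:R.
(** As 0^-1 = 0, this is the harmonic number H_(n-1) for n > 0. *)
Definition harm (n : nat) : R := \sum_(i < n) i%:R^-1.
Definition kerr n (m k : nat) : R := m%:R^-1 * (harm n - harm (n - m)).
Definition lsign (o : option letter) : R :=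
  if o is Some c then if c == lx then 1 else -1 else 0.

Lemma ktr_compl n A B C : lower A -> lower B ->
  ktr n C (kcomp A B) = \sum_(k < n) \sum_(m < n) (\sum_(j < n) C m j * A j k)
    * B k m.
Proof.
move=> lA lB; rewrite /ktr.
transitivity (\sum_(k < n) \sum_(m < n) \sum_(j < n) C m k * A k j * B j m).
  apply: eq_bigr => k _; apply: eq_bigr => m _.
  rewrite /kcomp (@kappE _ _ _ n) // mulr_sumr.
  by apply: eq_bigr => j _; rewrite mulrA.
rewrite exchange_big /=.
under eq_bigr do rewrite exchange_big.
rewrite exchange_big /=.
apply: eq_bigr => k _; apply: eq_bigr => m _; rewrite mulr_suml.
by [].
Qed.

(** Lower triangular matrices multiply exactly after truncation; the rest is the cyclicity tr(C A B)
    = tr(B C A). *)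
Lemma ktr_compr n A B C : lower A -> lower B ->
  ktr n C (kcomp A B) = \sum_(k < n) \sum_(m < n) (\sum_(j < n) B m j * C j k)
    * A k m.
Proof.
move=> lA lB; rewrite /ktr.
apply: eq_bigr => k _.
transitivity (\sum_(m < n) \sum_(j < n) C m k * A k j * B j m).
  apply: eq_bigr => m _.
  rewrite /kcomp (@kappE _ _ _ n) // mulr_sumr.
  by apply: eq_bigr => j _; rewrite mulrA.
rewrite exchange_big /=; apply: eq_bigr => m _; rewrite mulr_suml.
by apply: eq_bigr => j _; ring.
Qed.

Lemma harmS n : harm n.+1 = harm n + n%:R^-1.
Proof. by rewrite /harm big_ord_recr. Qed.

(** For m > 0, the partial fractions 1/(k (k - m)) = (1/(k - m) - 1/k)/m telescope over j < k < n.
    The terms depending on n add up to [- kerr n m j]. *)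
Lemma kQ_kletterY n m j : (m <= j < n)%N ->
  \sum_(k < n) kQ m k * kletter (Some ly) k j =
  m%:R^-1 * (harm (n - m) - harm (j.+1 - m) - (harm n - harm j.+1)).
Proof.
case: m => [|m] /andP[mj].
  by move=> _; rewrite invr0 mul0r big1 // => k _; rewrite /kQ !mul0r.
have m0 : m.+1%:R != 0 :> R by rewrite pnatr_eq0.
elim: n => // n IH; rewrite ltnS leq_eqVlt => /orP[/eqP->|jn].
  rewrite big1 ?subrr ?subr0 ?mulr0 // => k _.
  by rewrite /kletter /= ltnNge -ltnS ltn_ord mul0r mulr0.
rewrite big_ord_recr /= IH // (@subSn m.+1 n) ?harmS; last by lia.
have n0 : n%:R != 0 :> R by rewrite pnatr_eq0; lia.
have nm0 : n%:R - m.+1%:R != 0 :> R by rewrite -natrB ?pnatr_eq0; lia.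
have -> : kQ m.+1 n * kletter (Some ly) n j = m.+1%:R^-1 * ((n - m.+1)%:R^-1 -
  n%:R^-1).
  rewrite /kQ /kletter /= jn (leq_ltn_trans mj jn) natrB; last by lia.
  rewrite /= !mul1r; move: (m.+1%:R : R) (n%:R : R) m0 n0 nm0 => a b a0 b0 ab0.
  by field; rewrite a0 b0 ab0.
by ring.
Qed.

Lemma kletterY_kQ n m j : (m <= j < n)%N ->
  \sum_(k < n) kletter (Some ly) m k * kQ k j =
  m%:R^-1 * (harm j - harm (j.+1 - m)).
Proof.
case: m => [|m] /andP[mj jn].
  by rewrite invr0 mul0r big1 // => k _; rewrite /kletter invr0 mulr0 mul0r.
(* Left of the diagonal, a row of [kletter (Some ly)] is constant. *)
transitivity (m.+1%:R^-1 * \sum_(k < m.+1) kQ k j).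
  rewrite mulr_sumr (big_ord_widen n (fun k => _ * kQ k j)); last by lia.
  rewrite [RHS]big_mkcond /=; apply: eq_bigr => k _; rewrite /kletter /=.
  by case: ltnP => _ /=; rewrite ?mul0r ?mul1r.
congr (_ * _); elim: m mj => [|m IH] mj.
  by rewrite big_ord1 /kQ /= mul0r subn1 subrr.
rewrite big_ord_recr /= IH; last by lia.
have -> : (j.+1 - m.+1 = (j.+1 - m.+2).+1)%N by lia.
rewrite harmS /kQ /= mj mul1r subSS; ring.
Qed.

(** Once [kerr] is added, the two closed forms differ by (harm j.+1 - harm j)/m = 1/(m j). *)
Lemma kletterY_comm n m j : (m <= j < n)%N ->
  \sum_(k < n) kQ m k * kletter (Some ly) k j + kerr n m j =
  \sum_(k < n) kletter (Some ly) m k * kQ k j + kP m j.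
Proof.
move=> mjn; rewrite kQ_kletterY // kletterY_kQ // /kerr /kP harmS; ring.
Qed.

Lemma kletterX_sum n m (f : nat -> R) : (m < n)%N ->
  \sum_(k < n) kletter (Some lx) m k * f k = m%:R^-1 * f m.
Proof.
move=> mn; rewrite (bigD1 (Ordinal mn)) //= /kletter /= eqxx mul1r big1 ?addr0
  //.
by move=> k nk; rewrite [m == k]eq_sym (negbTE nk : (val k == m) = false)
  !mul0r.
Qed.

Lemma kletterX_sumr n m (f : nat -> R) : (m < n)%N ->
  \sum_(k < n) f k * kletter (Some lx) k m = f m / m%:R.
Proof.
move=> mn; rewrite (bigD1 (Ordinal mn)) //= /kletter /= eqxx mul1r big1 ?addr0
  //.
by move=> k nk; rewrite (negbTE nk : (val k == m) = false) mul0r mulr0.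
Qed.

(** The matrix of x is diagonal, so truncation causes no error: for m > 0 this is 1/(m (j - m)) -
    1/(j (j - m)) = 1/(m j). *)
Lemma kletterX_comm n m j : (m < j < n)%N ->
  \sum_(k < n) kletter (Some lx) m k * kQ k j =
  \sum_(k < n) kQ m k * kletter (Some lx) k j + kP m j.
Proof.
case/andP=> mj jn; have mn := ltn_trans mj jn.
rewrite (kletterX_sum (kQ^~ j)) // (kletterX_sumr (kQ m)) // /kQ /kP mj andbT.
case: m mj {mn} => [|m] mj; first by rewrite invr0 !mul0r addr0.
have m0 : m.+1%:R != 0 :> R by rewrite pnatr_eq0.
have j0 : j%:R != 0 :> R by rewrite pnatr_eq0; lia.
have jm0 : j%:R - m.+1%:R != 0 :> R by rewrite -natrB ?pnatr_eq0; lia.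
rewrite natrB; last by lia.
rewrite !mul1r; move: (m.+1%:R : R) (j%:R : R) m0 j0 jm0 => a b a0 b0 ab0.
by field; rewrite a0 b0 ab0.
Qed.

Lemma kletterS_split k m :
  kletter None k m = kletter (Some lx) k m + kletter (Some ly) k m.
Proof.
by rewrite /kletter /= -mulrDl -natrD; congr (_%:R / _); lia.
Qed.

(** The terms [kP] for x and y cancel; only the truncation error of y remains. *)
Lemma kletterS_comm n m j : (m < j < n)%N ->
  \sum_(k < n) kQ m k * kletter None k j + kerr n m j =
  \sum_(k < n) kletter None m k * kQ k j.
Proof.
move=> mjn; under eq_bigr do rewrite kletterS_split mulrDr.
under [RHS]eq_bigr do rewrite kletterS_split mulrDl.
rewrite !big_split /= kletterX_comm // -!addrA; congr (_ + _).
by rewrite kletterY_comm ?[_ + kP _ _]addrC //; lia.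
Qed.

(** With c the matrix of [o] and L that of [s], the left side is tr((c Q - Q c) L), and the
    commutator identities evaluate c Q - Q c entrywise. *)
Lemma rotation n s o : Some ly \in o :: s ->
  ktr n kQ (kword (rcons s o)) - ktr n kQ (kword (o :: s)) =
  lsign o * ktr n kP (kword s) + (o != Some lx)%:R * ktr n (kerr n) (kword s).
Proof.
move=> ys; have ls := @lower_kword s; have lo := @lower_kletter o.
have -> : ktr n kQ (kword (rcons s o)) = ktr n kQ (kcomp (kword s) (kletter o)).
  by apply: eq_bigr => k _; apply: eq_bigr => m _; rewrite kword_rcons.
rewrite ktr_compr //= ktr_compl // /ktr.
rewrite -sumrB !mulr_sumr -big_split; apply: eq_bigr => -[k kn] _ /=.
rewrite -sumrB !mulr_sumr -big_split; apply: eq_bigr => -[m mn] _ /=.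
have [km|mk] := ltnP k m; first by rewrite ls // !mulr0 subrr addr0.
rewrite -mulrBl ![_ * (_ * kword _ _ _)]mulrA -mulrDl.
move: ys; rewrite inE => /orP[/eqP<-|ys].
  rewrite /lsign /= mulN1r mul1r; congr (_ * _).
  by have := @kletterY_comm n m k; rewrite mk kn => /(_ isT) E; lra.
(* Here y occurs in [s], so the diagonal, which the identities for x and S do not cover, contributes
   nothing. *)
have [->|nkm] := eqVneq k m; first by rewrite kword_diag // !mulr0.
have mkn : (m < k < n)%N by rewrite kn ltn_neqAle eq_sym nkm mk.
congr (_ * _); case: o {lo} => [[]|] /=; rewrite ?mulN1r ?mul1r ?mul0r.
- by have := @kletterY_comm n m k; rewrite mk kn => /(_ isT) E; lra.
- by rewrite (kletterX_comm mkn); ring.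
- by rewrite -(kletterS_comm mkn); ring.
Qed.

(** * Harmonic sums and decay of the truncation error *)

Lemma ler_harm m n : (m <= n)%N -> harm m <= harm n.
Proof.
move=> /subnK <-; elim: (n - m)%N => // d IH; rewrite addSn harmS.
by apply: (le_trans IH); rewrite lerDl invr_ge0 ler0n.
Qed.

Lemma harm_ge0 n : 0 <= harm n.
Proof. by apply: sumr_ge0 => i _; rewrite invr_ge0 ler0n. Qed.

Lemma invn_ge0 n : 0 <= n%:R^-1 :> R.
Proof. by rewrite invr_ge0 ler0n. Qed.
Local Hint Resolve invn_ge0 : core.

Lemma invn_le1 n : n%:R^-1 <= 1 :> R.
Proof. by case: n => [|n]; rewrite ?invr0 ?ler01 // invf_le1 ?ler1n ?ltr0n. Qed.

Lemma sum_delta n m : \sum_(k < n) (val k == m)%:R <= 1 :> R.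
Proof.
have [mn|nm] := ltnP m n.
  rewrite (bigD1 (Ordinal mn)) //= eqxx big1 ?addr0 // => k nk.
  by rewrite (negbTE nk : (val k == m) = false).
by rewrite big1 ?ler01 // => k _; rewrite ltn_eqF ?(leq_trans (ltn_ord k)).
Qed.

Lemma kapp_kletter_le o f k : (forall j, 0 <= f j) ->
  kapp (kletter o) f k <= k%:R^-1 * \sum_(j < k.+1) f j.
Proof.
move=> f0; rewrite /kapp mulr_sumr ler_sum // => j _; rewrite ler_wpM2r //.
apply: (le_trans (kletter_None _ _ _)); rewrite /kletter ler_piMl //.
by rewrite lern1 leq_b1.
Qed.

Lemma kapp_kletterX f k : kapp (kletter (Some lx)) f k = k%:R^-1 * f k.
Proof. by rewrite /kapp (@kletterX_sum k.+1). Qed.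

(** Each letter is dominated entrywise by S, whose row k is 1/k up to the diagonal; summing the
    bound for the remaining word over that row costs a factor 1 + harm n. The Kronecker term comes
    from the empty word. *)
Lemma kword_le n s k m : (k < n)%N ->
  kword s k m <= (1 + harm n) ^+ size s * ((k == m)%:R + k%:R^-1).
Proof.
have h0 := harm_ge0 n.
elim: s k => [|o s IH] k kn /=; first by rewrite mul1r lerDl.
apply: (le_trans (kapp_kletter_le _ _ _)) => [j|]; first exact: kword_ge0.
apply: (@le_trans _ _ (k%:R^-1 * ((1 + harm n) ^+ size s * (1 + harm n)))).
  rewrite ler_wpM2l // (@le_trans _ _
    (\sum_(j < k.+1) (1 + harm n) ^+ size s * ((val j == m)%:R + j%:R^-1))) //.
    by apply: ler_sum => j _; apply: IH; apply: leq_trans kn.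
  rewrite -mulr_sumr ler_wpM2l ?exprn_ge0 ?addr_ge0 // big_split /=.
  by rewrite lerD ?sum_delta // ler_harm.
rewrite -exprSr mulrC ler_wpM2l ?exprn_ge0 ?addr_ge0 //.
by rewrite lerDr ler0n.
Qed.

(** The letter x multiplies row k by 1/k, and the word after it vanishes there unless m <= k, so
    that 1/k <= 1/m. The letters before x keep this factor 1/m. *)
Lemma kwordX_le n s k m : Some lx \in s -> (0 < m)%N -> (k < n)%N ->
  kword s k m <= (1 + harm n) ^+ size s * (((k == m)%:R + k%:R^-1) / m%:R).
Proof.
have h0 := harm_ge0 n; move=> xs m0; elim: s xs k => // o s IH.
have [<- _ k kn|no xs k kn] := eqVneq (Some lx) o.
  rewrite /= /kcomp kapp_kletterX exprS.
  have [km|mk] := ltnP k m.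
    rewrite lower_kword // mulr0 !mulr_ge0 ?addr_ge0 ?exprn_ge0 ?addr_ge0
      ?ler0n //.
  apply: (le_trans (ler_wpM2l _ (kword_le _ _ kn))) => //.
  rewrite mulrCA -mulrA; set B := ((k == m)%:R + _).
  have B0 : 0 <= B by rewrite addr_ge0 ?ler0n.
  apply: (@le_trans _ _ ((1 + harm n) ^+ size s * (B / m%:R))); last first.
    by rewrite ler_peMl ?lerDl // mulr_ge0 ?exprn_ge0 ?addr_ge0 ?mulr_ge0.
  rewrite ler_wpM2l ?exprn_ge0 ?addr_ge0 // mulrC ler_wpM2l //.
  by rewrite lef_pV2 ?posrE ?ltr0n ?ler_nat // (leq_trans m0).
have {}xs : Some lx \in s by move: xs; rewrite inE (negbTE no).
rewrite /=; apply: (le_trans (kapp_kletter_le _ _ _)) => [j|].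
  exact: kword_ge0.
apply: (@le_trans _ _ (k%:R^-1 * ((1 + harm n) ^+ size s * ((1 + harm n) /
  m%:R)))).
  rewrite ler_wpM2l // (@le_trans _ _ (\sum_(j < k.+1)
    (1 + harm n) ^+ size s * (((val j == m)%:R + j%:R^-1) / m%:R))) //.
    by apply: ler_sum => j _; apply: IH => //; apply: leq_trans kn.
  rewrite -mulr_sumr ler_wpM2l ?exprn_ge0 ?addr_ge0 // -mulr_suml ler_wpM2r //.
  by rewrite big_split /= lerD ?sum_delta // ler_harm.
rewrite mulrA -exprSr mulrCA ler_wpM2l ?exprn_ge0 ?addr_ge0 // ler_wpM2r //.
by rewrite lerDr ler0n.
Qed.

Lemma harm_sub_le n m : (m < n)%N -> harm n - harm (n - m) <= m%:R / (n - m)%:R.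
Proof.
move=> mn; rewrite lerBlDl; rewrite -{1}(subnK (ltnW mn)).
elim: m mn => [|m IH] mn; first by rewrite addn0 mul0r addr0.
rewrite (_ : n - m.+1 + m.+1 = n - m + m)%N; last by lia.
rewrite (le_trans (IH (ltnW mn))) //.
rewrite (_ : n - m = (n - m.+1).+1)%N ?harmS; last by lia.
rewrite -addrA lerD2l -[m.+1 in leRHS]add1n natrD mulrDl mul1r lerD2l ler_wpM2l
  //.
by rewrite lef_pV2 ?posrE ?ltr0n ?ler_nat //; lia.
Qed.

Lemma kerr_ge0 n m k : 0 <= kerr n m k.
Proof. by rewrite mulr_ge0 // subr_ge0 ler_harm ?leq_subr. Qed.

Lemma ktr_kerr_ge0 n s : 0 <= ktr n (kerr n) (kword s).
Proof.
by apply: sumr_ge0 => k _; apply: sumr_ge0 => m _;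
  rewrite mulr_ge0 ?kerr_ge0 ?kword_ge0.
Qed.

(** For m > 0, 1/(m (n - m)) = (1/m + 1/(n - m))/n. *)
Lemma sum_inv_cross n : \sum_(m < n) m%:R^-1 / (n - m)%:R <= n%:R^-1 * (2 * (1
  + harm n)).
Proof.
have rev : \sum_(m < n) (n - m)%:R^-1 = harm n.+1.
  rewrite (reindex_inj rev_ord_inj) /= /harm big_ord_recl /= invr0 add0r.
  by apply: eq_bigr => i _; congr (_%:R^-1); have := ltn_ord i;
    rewrite /bump /=; lia.
apply: (@le_trans _ _ (n%:R^-1 * \sum_(m < n) (m%:R^-1 + (n - m)%:R^-1))).
  rewrite mulr_sumr ler_sum // => -[m mn] _ /=; case: m mn => [|m] mn.
    by rewrite invr0 mul0r add0r mulr_ge0.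
  have n0 : n%:R != 0 :> R by rewrite pnatr_eq0; lia.
  have m0 : m.+1%:R != 0 :> R by rewrite pnatr_eq0.
  have nm0 : n%:R - m.+1%:R != 0 :> R by rewrite -natrB ?pnatr_eq0; lia.
  rewrite natrB; last by lia.
  move: (m.+1%:R : R) (n%:R : R) m0 n0 nm0 => a b a0 b0 ab0.
  by rewrite le_eqVlt; apply/orP; left; apply/eqP; field; rewrite a0 b0 ab0.
rewrite ler_wpM2l // big_split /= rev harmS -/(harm n).
by have := invn_le1 n; have := harm_ge0 n; lra.
Qed.

(** By [harm_sub_le], [kerr n m k] is at most 1/(n - m) for m > 0. The factor 1/m from the letter x
    turns this into the sum of [sum_inv_cross], whence the decay 1/n; the sums over k and m each add
    one factor 1 + harm n. *)
Lemma ktr_kerr_le n s : Some lx \in s ->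
  ktr n (kerr n) (kword s) <= 2 * ((1 + harm n) ^+ (size s).+2 / n%:R).
Proof.
have h0 := harm_ge0 n; move=> xs.
have hs0 : 0 <= (1 + harm n) ^+ size s by rewrite exprn_ge0 ?addr_ge0.
pose g m : R := m%:R^-1 / (n - m)%:R.
have g0 m : 0 <= g m by rewrite mulr_ge0.
apply: (@le_trans _ _ ((1 + harm n) ^+ size s *
    \sum_(k < n) \sum_(m < n) ((val k == m)%:R + k%:R^-1) * g m)).
  rewrite mulr_sumr ler_sum // => -[k kn] _;
    rewrite mulr_sumr ler_sum // => -[m mn] _ /=.
  rewrite /kerr; case: m mn => [|m] mn.
    by rewrite invr0 !mul0r !mulr_ge0 // addr_ge0 ?ler0n.
  have -> : (1 + harm n) ^+ size s * (((k == m.+1)%:R + k%:R^-1) * g m.+1) =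
    m.+1%:R^-1 * (m.+1%:R / (n - m.+1)%:R) *
    ((1 + harm n) ^+ size s * (((k == m.+1)%:R + k%:R^-1) / m.+1%:R)).
    by rewrite (mulrA m.+1%:R^-1) mulVf ?pnatr_eq0 // /g; ring.
  apply: ler_pM; rewrite ?kword_ge0 ?kwordX_le ?kerr_ge0 //.
  by rewrite ler_wpM2l ?harm_sub_le.
rewrite exchange_big /=.
apply: (@le_trans _ _ ((1 + harm n) ^+ size s * ((1 + harm n) * \sum_(m < n) g
  m))).
  rewrite ler_wpM2l // mulr_sumr ler_sum // => m _;
    rewrite -mulr_suml ler_wpM2r //.
  by rewrite big_split /= lerD ?sum_delta.
apply: (@le_trans _ _ ((1 + harm n) ^+ size s * ((1 + harm n) *
  (n%:R^-1 * (2 * (1 + harm n)))))).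
  by rewrite ler_wpM2l // ler_wpM2l ?addr_ge0 // sum_inv_cross.
by rewrite !exprS le_eqVlt; apply/orP; left; apply/eqP; ring.
Qed.

Lemma exprB_le (a b : R) r : 0 <= b <= a ->
  a ^+ r.+1 <= b ^+ r.+1 + r.+1%:R * a ^+ r * (a - b).
Proof.
case/andP=> b0 ba; have a0 := le_trans b0 ba.
elim: r => [|r IH]; first by rewrite !expr1 expr0; lra.
have : b ^+ r.+1 <= a ^+ r.+1 by rewrite lerXn2r.
move: IH; rewrite (exprS a r.+1) (exprS b r.+1) (exprS a r) -[r.+2]addn1 natrD.
move: (b ^+ r.+1) (a ^+ r) (r.+1%:R : R) => B A c IH BA.
have := ler_wpM2l a0 IH; have : (a - b) * B <= (a - b) * (a * A).
  by rewrite ler_wpM2l ?subr_ge0.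
by nra.
Qed.

(** The last bound follows from (b - a)(b + a) = 1 and a <= b. *)
Lemma sqrt_natS_sub k (a := Num.sqrt k%:R : R) (b := Num.sqrt k.+1%:R : R) :
  [/\ 0 <= a <= b, 0 < b & 1 <= 2 * b * (b - a)].
Proof.
have a0 : 0 <= a by exact: sqrtr_ge0.
have b0 : 0 < b by rewrite sqrtr_gt0 ltr0n.
have ab : a <= b by rewrite ler_sqrt ?ler_nat ?ltr0n.
have a2 : a ^+ 2 = k%:R by rewrite sqr_sqrtr ?ler0n.
have b2 : b ^+ 2 = k%:R + 1 by rewrite sqr_sqrtr ?ler0n // natr1.
by split; rewrite ?a0 ?ab //; nra.
Qed.

(** Induction on r, then on k, comparing increments: [exprB_le] and the bound for r control the
    growth of the power, [sqrt_natS_sub] that of the square root. *)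
Lemma harm_pow_le r : exists2 C : R, 0 <= C &
  forall k, (0 < k)%N -> (1 + harm k.+1) ^+ r <= C * Num.sqrt k%:R.
Proof.
elim: r => [|r [C C0 IH]].
  by exists 1 => // k k0; rewrite mul1r expr0 -{1}sqrtr1 ler_sqrt ?ler1n ?ltr0n.
(* The first constant serves the increments, the second the case k = 1, where harm 2 = 1. *)
pose D := Num.max (2 * (r.+1%:R * C)) (2 ^+ r.+1).
have D0 : 0 <= D by rewrite le_max (exprn_ge0 r.+1) ?orbT.
exists D => // -[//|k] _; elim: k => [|k IHk].
  by rewrite sqrtr1 mulr1 !harmS /harm big_ord0 invr0 invr1 !add0r le_max lexx
    orbT.
have h0 := harm_ge0 k.+2.
apply: (le_trans (@exprB_le _ (1 + harm k.+2) r _)).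
  by rewrite addr_ge0 // lerD2l ler_harm.
rewrite (harmS k.+2) (_ : _ - _ = k.+2%:R^-1); last by ring.
rewrite -harmS; have := IH k.+2 isT; have [] := sqrt_natS_sub k.+1.
have : Num.sqrt k.+2%:R ^+ 2 = k.+2%:R :> R by rewrite sqr_sqrtr.
move: IHk; set a := Num.sqrt k.+1%:R; set b := Num.sqrt k.+2%:R.
move=> IHk <- /andP[a0 ab] b0 h1 IHb.
have -> : D * b = D * a + D * (b - a) by ring.
rewrite lerD //; apply: (@le_trans _ _ (r.+1%:R * (C * b) / b ^+ 2)).
  by rewrite ler_wpM2r ?invr_ge0 ?sqr_ge0 // ler_wpM2l.
have -> : r.+1%:R * (C * b) / b ^+ 2 = (2 * (r.+1%:R * C)) / (2 * b).
  by field; rewrite gt_eqF.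
rewrite ler_pdivrMr ?mulr_gt0 //.
apply: (@le_trans _ _ D); first by rewrite le_max lexx.
by nra.
Qed.

(** Telescoping comparison k^(-3/2) <= 2/sqrt(k - 1) - 2/sqrt(k) for k >= 2. *)
Lemma sum_inv_sqrt3 n : \sum_(k < n) (Num.sqrt k%:R ^+ 3)^-1 <= 3 :> R.
Proof.
suff bound m : \sum_(k < m.+2) (Num.sqrt k%:R ^+ 3)^-1 <= 3 - 2 / Num.sqrt
  m.+1%:R :> R.
  case: n => [|[|n]]; rewrite ?big_ord0 ?big_ord1 ?sqrtr0 ?expr0n ?invr0 //.
  by apply: (le_trans (bound n)); rewrite gerBl mulr_ge0 ?invr_ge0 ?sqrtr_ge0.
elim: m => [|m IH].
  by rewrite !big_ord_recr big_ord0 /= sqrtr0 sqrtr1 expr0n expr1n invr0 invr1;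
    lra.
rewrite big_ord_recr /=; have [] := sqrt_natS_sub m.+1.
have : 0 < Num.sqrt m.+1%:R :> R by rewrite sqrtr_gt0 ltr0n.
move: IH; set a := Num.sqrt m.+1%:R; set b := Num.sqrt m.+2%:R.
move=> IH a0 /andP[_ ab] b0 h1.
suff : (b ^+ 3)^-1 <= 2 / a - 2 / b by move: IH; lra.
have -> : 2 / a - 2 / b = (2 * b * (b - a)) * (b / a) / b ^+ 3.
  by field; rewrite !gt_eqF.
rewrite -{1}[_^-1]mul1r ler_wpM2r ?invr_ge0 ?exprn_ge0 ?(ltW b0) //.
by rewrite -[leLHS]mulr1 ler_pM // ler_pdivlMr ?mul1r.
Qed.

(** * Rotations in the limit *)

Definition null (f : nat -> R) := f n @[n --> \oo] --> (0 : R).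

Lemma nullD f g : null f -> null g -> null (fun n => f n + g n).
Proof. by move=> f0 g0; rewrite /null -[0]addr0; exact: cvgD. Qed.

Lemma nullZ a f : null f -> null (fun n => a * f n).
Proof. by move=> f0; rewrite /null -(mulr0 a); exact: cvgMr. Qed.

Lemma eq_null f g : f =1 g -> null f -> null g.
Proof. by move=> /funext ->. Qed.

Lemma harm_pow_null r : null (fun n => (1 + harm n) ^+ r / n%:R).
Proof.
have [C C0 HC] := harm_pow_le r.
have h0 n : 0 <= (1 + harm n) ^+ r by rewrite exprn_ge0 // addr_ge0 // harm_ge0.
rewrite /null -cvg_shiftS -cvg_shiftS /=.
apply: (@squeeze_cvgr _ _ _ _ (fun=> 0) (fun k => C * Num.sqrt k.+1%:R^-1)).
- apply: nearW => k; apply/andP; split; first by rewrite mulr_ge0.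
  apply: (@le_trans _ _ (C * Num.sqrt k.+1%:R / k.+1%:R)).
    apply: ler_pM => //; first exact: HC.
    by rewrite lef_pV2 ?posrE ?ltr0n ?ler_nat.
  rewrite -mulrA ler_wpM2l // sqrtrV ?ler0n //.
  have s0 : Num.sqrt k.+1%:R != 0 :> R by rewrite sqrtr_eq0 -ltNge ltr0n.
  by rewrite -{2}[k.+1%:R](@sqr_sqrtr R) ?ler0n // expr2 invfM mulrA divff //
    mul1r.
- exact: cvg_cst.
rewrite -(mulr0 C) -(sqrtr0 R); apply: cvgMr.
apply: (cvg_comp _ _ (@cvg_harmonic R)).
exact: sqrt_continuous.
Qed.

Lemma ktr_kerr_null s : Some lx \in s ->
  null (fun n => ktr n (kerr n) (kword s)).
Proof.
move=> xs; apply: (@squeeze_cvgr _ _ _ _ (fun=> 0)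
  (fun n => 2 * ((1 + harm n) ^+ (size s).+2 / n%:R))).
- by apply: nearW => n; rewrite ktr_kerr_ge0 ktr_kerr_le.
- exact: cvg_cst.
exact/nullZ/harm_pow_null.
Qed.

(** Rotating x causes no error; when [o] is another letter, x occurs in [s] and the error tends to
    0. *)
Lemma rotation_null s o : Some lx \in o :: s -> Some ly \in o :: s ->
  null (fun n => ktr n kQ (kword (rcons s o)) - ktr n kQ (kword (o :: s))
                 - lsign o * ktr n kP (kword s)).
Proof.
move=> xs ys.
apply: (@eq_null (fun n => (o != Some lx)%:R * ktr n (kerr n) (kword s))) =>
  [n|].
  by rewrite rotation // addrC addKr.
have [_|no] := eqVneq o (Some lx).
  by apply: (@eq_null (fun=> 0)) => [n|]; [rewrite mul0r|exact: cvg_cst].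
apply/nullZ/ktr_kerr_null.
by move: xs; rewrite inE eq_sym (negbTE no).
Qed.

(** Here [p] holds the letters already passed, [s] those still to be removed, and [t] the block of
    letters S; cutting the cyclic word at [o] leaves [s' ++ t ++ p]. *)
Fixpoint cyclic_sum n (t p s : seq (option letter)) : R :=
  if s is o :: s' then
    lsign o * ktr n kP (kword (s' ++ t ++ p)) + cyclic_sum n t (rcons p o) s'
  else 0.

(** The summand of [o] accounts for rotating [o :: s ++ t ++ p] into [s ++ t ++ rcons p o]; the
    intermediate traces cancel. *)
Lemma cyclic_sum_telescope t p s :
  Some lx \in t ++ p ++ s -> Some ly \in t ++ p ++ s ->
  null (fun n => ktr n kQ (kword (t ++ p ++ s)) - ktr n kQ (kword (s ++ t ++ p))
                 - cyclic_sum n t p s).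
Proof.
elim: s p => [|o s IH] p xs ys /=.
  by apply: (@eq_null (fun=> 0)) => [n|];
    [rewrite cats0 subrr subr0|exact: cvg_cst].
have mem c : (c \in o :: s ++ t ++ p) = (c \in t ++ p ++ o :: s).
  by rewrite !(inE, mem_cat); case: (c == o); case: (c \in s); case: (c \in t);
     rewrite ?orbT ?orbF.
have := rotation_null (o := o) (s := s ++ t ++ p).
rewrite !mem => /(_ xs ys) lim1.
have := IH (rcons p o); rewrite cat_rcons => /(_ xs ys) lim2.
apply: eq_null (nullD lim1 lim2) => n /=.
rewrite !rcons_cat; ring.
Qed.

Lemma rotation_None_null m w p : Some lx \in w -> Some ly \in w ->
  null (fun n => ktr n kQ (kword (w ++ p ++ nseq m None))
               - ktr n kQ (kword (nseq m None ++ w ++ p))).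
Proof.
move=> xw yw; elim: m p => [|m IH] p.
  by apply: (@eq_null (fun=> 0)) => [n|];
    [rewrite /= cats0 subrr|exact: cvg_cst].
have lim1 := @rotation_null (nseq m None ++ w ++ p) None.
rewrite !(inE, mem_cat) xw yw !orbT in lim1.
have lim2 := IH (p ++ [:: None]); rewrite -!catA in lim2.
apply: eq_null (nullD (lim1 isT isT) lim2) => n /=.
by rewrite mul0r subr0 !rcons_cat -!cats1; ring.
Qed.

(** Rotating the letters of [w] links the traces of [t ++ w] and [w ++ t], where [t] is the block of
    letters S; moving [t] back around closes the circle. *)
Lemma cyclic_sum_null m w : Some lx \in w -> Some ly \in w ->
  null (fun n => cyclic_sum n (nseq m None) [::] w).
Proof.
move=> xw yw.
have lim1 := @cyclic_sum_telescope (nseq m None) [::] w.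
rewrite !mem_cat xw yw !orbT in lim1.
have lim2 := rotation_None_null m [::] xw yw.
apply: eq_null (nullZ (-1) (nullD (lim1 isT isT) lim2)) => n.
by rewrite /= !cats0; ring.
Qed.

(** * Zeta-star values as limits of truncated sums *)

(* The summand at j = 0 vanishes when a > 0, as 0^-1 = 0. *)
Fixpoint star_trunc (ks : seq nat) (M : nat) : R :=
  if ks is a :: ks' then \sum_(j < M.+1) (j%:R ^+ a)^-1 * star_trunc ks' j else
    1.

Lemma star_trunc_ge0 ks M : 0 <= star_trunc ks M.
Proof.
elim: ks M => [|a ks IH] M /=; first exact: ler01.
by apply: sumr_ge0 => j _; rewrite mulr_ge0 // invr_ge0 exprn_ge0.
Qed.

Definition star_term (ks : seq nat) (m : (size ks).-tuple nat) : R :=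
  \prod_(i < size ks) ((tnth m i)%:R ^+ nth 0%N ks i)^-1.

Lemma star_term_ge0 ks m : 0 <= @star_term ks m.
Proof. by apply: prodr_ge0 => i _; rewrite invr_ge0 exprn_ge0. Qed.

Lemma star_term_cons a ks j (m : (size ks).-tuple nat) :
  @star_term (a :: ks) [tuple of j :: m] = (j%:R ^+ a)^-1 * star_term m.
Proof.
rewrite /star_term big_ord_recl tnth0; congr (_ * _).
by apply: eq_bigr => i _; rewrite tnthS.
Qed.

Definition chain n (M : nat) : set (n.-tuple nat) :=
  [set m | path geq M m && all (fun i => 0 < i)%N m].

(** The largest index j is split off. The predicate [D] bounds it for truncated sums and is trivial
    for [zeta_star]; the constant [c] absorbs the outer factors in the induction. *)
Lemma esum_star_cons (D : pred nat) (c : R) a ks : 0 <= c ->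
  (forall M (c : R), 0 <= c ->
    (\esum_(m in @chain (size ks) M) (c * star_term m)%:E
     = (c * star_trunc ks M)%:E)%E) ->
  (\esum_(m in [set m : (size ks).+1.-tuple nat |
      [&& D (thead m), sorted geq m & all (fun i => 0 < i)%N m]])
      (c * @star_term (a :: ks) m)%:E
   = \esum_(j in [set j | D j && (0 < j)%N])
       (c * ((j%:R ^+ a)^-1 * star_trunc ks j))%:E)%E.
Proof.
move=> c0 IH.
transitivity (\esum_(j in [set j | D j && (0 < j)%N]) \esum_(m in @chain (size
  ks) j)
    (c * @star_term (a :: ks) [tuple of j :: m])%:E)%E; last first.
  apply: eq_esum => j _; rewrite mulrA -IH ?mulr_ge0 ?invr_ge0 ?exprn_ge0 //.
  by apply: eq_esum => m _; rewrite star_term_cons mulrA.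
rewrite esum_esum => [|j m _ _]; last by rewrite lee_fin mulr_ge0
  ?star_term_ge0.
pose e (z : nat * (size ks).-tuple nat) : (size ks).+1.-tuple nat :=
  [tuple of z.1 :: z.2].
rewrite (@reindex_esum R _ _ ([set j | D j && (0 < j)%N] `*`` @chain (size ks))
  _ e) //.
split.
- move=> [j m] [/= /andP[Dj j0] /andP[jm m0]].
  by rewrite /e theadE Dj jm j0 m0.
- by move=> [j m] [j' m'] _ _ /(congr1 val) [-> /val_inj ->].
move=> m /=; case/tupleP: m => j m; rewrite theadE /= => /and3P[Dj jm /andP[j0
  m0]].
by exists (j, m) => //=; split; apply/andP.
Qed.

Lemma esum_star_chain ks M (c : R) : all (fun a => 0 < a)%N ks -> 0 <= c ->
  (\esum_(m in @chain (size ks) M) (c * star_term m)%:E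
   = (c * star_trunc ks M)%:E)%E.
Proof.
elim: ks M c => [|a ks IH] M c /=.
  move=> _ c0; rewrite (_ : chain M = [set [tuple]]).
    by rewrite esum_set1 /star_term ?big_ord0 ?mulr1 ?lee_fin.
  by apply/seteqP; split=> m _ /=; rewrite ?tuple0.
case/andP=> a0 /(fun h M c => IH M c h) {}IH c0.
have := esum_star_cons (fun j => (j <= M)%N) a c0 IH.
rewrite (_ : [set m | _] = @chain (size ks).+1 M); last first.
  apply/seteqP; split=> m; rewrite /chain /=; case/tupleP: m => j m;
    by rewrite theadE /= -andbA.
move=> ->; rewrite esum_fset.
- rewrite fsumEFin; last by apply: (sub_finite_set _ (finite_II M.+1)) => j
  /andP[].
  congr (_%:E); rewrite mulr_sumr (fsbig_widen _ `I_M.+1).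
  + by rewrite -fsbig_ord.
  + by move=> j /andP[].
  + move=> j /= [jM /negP]; rewrite -ltnS jM -eqn0Ngt => /eqP ->.
    by rewrite expr0n eqn0Ngt a0 invr0 mul0r mulr0.
- by apply: (sub_finite_set _ (finite_II M.+1)) => j /andP[].
move=> j _; rewrite lee_fin !mulr_ge0 ?star_trunc_ge0 // invr_ge0 exprn_ge0 //.
Qed.

Lemma zeta_starE ks (l : R) : all (fun a => 0 < a)%N ks ->
  star_trunc ks M @[M --> \oo] --> l -> zeta_star R ks = l.
Proof.
case: ks => [|a ks] /=.
  move=> _ /(cvg_lim (@Rhausdorff R)) <-; rewrite lim_cst //.
  rewrite /zeta_star /= (_ : [set _ | _] = [set [tuple]]).
    by rewrite esum_set1 ?big_ord0 ?lee_fin.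
  by apply/seteqP; split=> m _ /=; rewrite ?tuple0.
case/andP=> a0 ks0 cl.
have := esum_star_cons xpredT a ler01 (fun M c => @esum_star_chain ks M c ks0).
rewrite /zeta_star /=; under eq_esum do rewrite mul1r; move=> ->.
rewrite -(nneseries_esum _ (P := fun j => 0 < j)%N); last first.
  by move=> j _; rewrite lee_fin mul1r mulr_ge0 ?star_trunc_ge0 // invr_ge0
    exprn_ge0.
rewrite (cvg_lim _ (l := l%:E)) //.
rewrite -cvg_shiftS /=; apply: cvg_EFin; first by apply: nearW => M;
  rewrite sumEFin.
apply: cvg_trans cl; apply: near_eq_cvg; apply: nearW => M /=.
rewrite sumEFin /= big_mkord [RHS]big_mkcond;
  apply: eq_bigr => -[[|j] jM] _ //=.
  by rewrite expr0n eqn0Ngt a0 invr0 mul0r.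
by rewrite mul1r.
Qed.

(** * Words as coefficient sequences *)

Definition star_letter (c : letter) : option letter :=
  if c == lx then Some lx else None.

(** The letters act on the constant power series 1. *)
Definition word_coef (s : seq letter) : nat -> R :=
  foldr (fun c => kapp (kletter (star_letter c))) (fun k => (k == 0)%N%:R) s.

Lemma word_coef_ge0 s k : 0 <= word_coef s k.
Proof.
elim: s k => [|c s IH] k; first exact: ler0n.
by apply: kapp_ge0 => // j; exact: kletter_ge0.
Qed.

Lemma kapp_kletterS f k : kapp (kletter None) f k = k%:R^-1 * \sum_(j < k.+1) f
  j.
Proof.
rewrite /kapp mulr_sumr; apply: eq_bigr => j _.
by rewrite /kletter -ltnS ltn_ord mul1r.
Qed.

Lemma index_of_word_gt0 a s : all (fun i => 0 < i)%N (index_of_word a s).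
Proof. by elim: s a => //= c s IH a; case: ifP => //= _. Qed.

(** The default of [last] rules out pending letters x with nothing left to read, which
    [index_of_word] would drop. *)
Lemma star_trunc_index a s M : last (if a is 0 then ly else lx) s = ly ->
  star_trunc (index_of_word a s) M =
  \sum_(j < M.+1) (j%:R ^+ a)^-1 * word_coef s j.
Proof.
elim: s a M => [|[] s IH] a M /=.
- case: a => // _; rewrite big_ord_recl /= mulr1 expr0 invr1 big1 ?addr0 // =>
  j _.
  by rewrite mulr0.
- move=> sy; apply: eq_bigr => j _; rewrite IH // kapp_kletterS.
  by rewrite mulrA exprSr invfM; congr (_ * _); apply: eq_bigr => i _;
    rewrite expr0 invr1 mul1r.
move=> sy; rewrite IH //; apply: eq_bigr => j _.
by rewrite kapp_kletterX mulrA exprSr invfM.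
Qed.

Lemma word_coef_le s k :
  word_coef (rcons s ly) k <= (1 + harm k.+1) ^+ size s * k%:R^-1.
Proof.
elim: s k => [|c s IH] k /=.
  rewrite mul1r (le_trans (kapp_kletter_le _ _ _)) // ler_piMr //.
  exact: (sum_delta k.+1 0).
rewrite (le_trans (kapp_kletter_le _ _ _)) // => [j|];
  first exact: word_coef_ge0.
rewrite mulrC ler_wpM2r // exprSr.
apply: (@le_trans _ _ ((1 + harm k.+1) ^+ size s * harm k.+1)); last first.
  by rewrite ler_wpM2l ?exprn_ge0 ?addr_ge0 ?harm_ge0 // lerDr.
rewrite mulr_sumr ler_sum // => j _; apply: (le_trans (IH j)).
rewrite ler_wpM2r // lerXn2r ?nnegrE ?addr_ge0 ?harm_ge0 //.
by rewrite lerD2l ler_harm // ltn_ord.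
Qed.

(** The leading x makes the k-th term at most (1 + harm k.+1)^(size s)/k^2 <= C k^(-3/2) for k > 0,
    so the nondecreasing partial sums are bounded. *)
Lemma zeta_star_word_cvg s :
  \sum_(k < n) word_coef (lx :: rcons s ly) k @[n --> \oo]
    --> zeta_star R (index_of_word 0 (lx :: rcons s ly)).
Proof.
set w := lx :: rcons s ly; pose u n := \sum_(k < n) word_coef w k.
have [C C0 HC] := harm_pow_le (size s).
have cu : cvgn u.
  apply: nondecreasing_is_cvgn.
    apply/nondecreasing_seqP => n; rewrite /u big_ord_recr /= lerDl.
    exact: (word_coef_ge0 w).
  exists (C * 3) => _ [n _ <-]; rewrite /u.
  apply: (@le_trans _ _ (\sum_(k < n) C * (Num.sqrt k%:R ^+ 3)^-1)).
    apply: ler_sum => -[k kn] _ /=; rewrite kapp_kletterX.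
    case: k kn => [|k] kn; first by rewrite invr0 mul0r sqrtr0 expr0n invr0
      mulr0.
    apply: (le_trans (ler_wpM2l _ (word_coef_le s k.+1))) => //.
    have sk : 0 < Num.sqrt k.+1%:R :> R by rewrite sqrtr_gt0 ltr0n.
    have sk2 : Num.sqrt k.+1%:R ^+ 2 = k.+1%:R :> R by rewrite sqr_sqrtr.
    apply: (@le_trans _ _ (k.+1%:R^-1 * (C * Num.sqrt k.+1%:R * k.+1%:R^-1))).
      by rewrite ler_wpM2l // ler_wpM2r // HC.
    move: (Num.sqrt _) sk sk2 => a /lt0r_neq0 a0 <-.
    by rewrite le_eqVlt; apply/orP; left; apply/eqP; field.
  by rewrite -mulr_sumr ler_wpM2l // sum_inv_sqrt3.
rewrite (@zeta_starE _ (limn u)) ?index_of_word_gt0 //.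
have : u n @[n --> \oo] --> limn u by [].
(* [star_trunc] at M includes the index M, whereas [u] at M stops before it. *)
rewrite -(cvg_shiftS u); apply: cvg_trans.
apply: near_eq_cvg; apply: nearW => M /=.
rewrite (star_trunc_index (a := 0) (s := w)); last by rewrite /= last_rcons.
by apply: eq_bigr => j _; rewrite expr0 invr1 mul1r.
Qed.

Lemma mmap_ratr_linear (f : word -> R) c (g h : H) :
  mmap (@ratr R) f (c *: g + h) = ratr c * mmap (@ratr R) f g + mmap (@ratr R)
    f h.
Proof.
rewrite mmapD; congr (_ + _).
rewrite (mmapEw (msuppZ_le c g)) mmapE mulr_sumr.
apply: eq_bigr => w _; rewrite [RHS]mulrA mcoeffZ; congr (_ * _);
  exact: rmorphM.
Qed.

Lemma mmap_ratr_word (f : word -> R) (w : word) :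
  mmap (@ratr R) f << w >> = f w.
Proof. by rewrite mmapE msuppU oner_eq0 big_seq_fset1 mcoeffUU rmorph1 mul1r.
  Qed.

Definition coef (k : nat) (h : H) : R := mmap (@ratr R) (fun w : word =>
  word_coef w k) h.

Lemma coef_linear k c (g h : H) : coef k (c *: g + h) = ratr c * coef k g +
  coef k h.
Proof. exact: mmap_ratr_linear. Qed.

Lemma coef0 k : coef k 0 = 0.
Proof. exact: mmap0. Qed.

Lemma coefB k (g h : H) : coef k (g - h) = coef k g - coef k h.
Proof. exact: mmapB. Qed.

Lemma coef_word k s : coef k << FMonom s >> = word_coef s k.
Proof. exact: mmap_ratr_word. Qed.

Lemma kapp_linear A (c : R) f g k :
  kapp A (fun j => c * f j + g j) k = c * kapp A f k + kapp A g k.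
Proof.
rewrite /kapp mulr_sumr -big_split; apply: eq_bigr => j _ /=; ring.
Qed.

Lemma coef_gen_mul k c (h : H) :
  coef k (gen c * h) = kapp (kletter (star_letter c)) (coef ^~ h) k.
Proof.
elim/malg_basis_ind: h => [d g1 g2 IH1 IH2||[s]].
- rewrite mulrDr malg_scaleAr coef_linear.
  apply: (etrans (congr2 (fun a b => ratr d * a + b) IH1 IH2)).
  rewrite -kapp_linear; apply: eq_kapp => j;
    exact: (esym (coef_linear j d g1 g2)).
- by rewrite mulr0 coef0 /kapp big1 // => j _; rewrite coef0 mulr0.
rewrite -FMonom_cons coef_word /=; apply: eq_kapp => j.
by rewrite coef_word.
Qed.

Lemma kapp_kletterY f k :
  kapp (kletter (Some ly)) f k = kapp (kletter None) f k - kapp (kletter (Some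
    lx)) f k.
Proof.
rewrite /kapp -sumrB; apply: eq_bigr => j _.
by rewrite kletterS_split mulrDl addrC addKr.
Qed.

(** As gamma^-1(y) = y - x, it acts as S - X = Y. *)
Lemma coef_gammaV_gen_mul k c (h : H) :
  coef k (gammaV (gen c) * h) = kapp (kletter (Some c)) (coef ^~ h) k.
Proof.
rewrite /gammaV subst_gen; case: c => /=; last exact: coef_gen_mul.
rewrite kapp_kletterY mulrBl coefB.
exact: (congr2 (fun a b => a - b) (coef_gen_mul k ly h) (coef_gen_mul k lx h)).
Qed.

Lemma coef_gammaV_word_mul k s (h : H) :
  coef k (gammaV << FMonom s >> * h) =
  foldr (fun o => kapp (kletter o)) (coef ^~ h) (map Some s) k.
Proof.
elim: s k => [|c s IH] k; first by rewrite FMonom0 gammaV1 mul1r.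
rewrite FMonom_cons gammaVM -mulrA coef_gammaV_gen_mul /=.
exact: eq_kapp.
Qed.

Lemma coef_Yexp_mul k m (h : H) :
  coef k (Y ^+ m * h) =
  foldr (fun o => kapp (kletter o)) (coef ^~ h) (nseq m None) k.
Proof.
elim: m k => [|m IH] k; first by rewrite expr0 mul1r.
by rewrite exprS -mulrA coef_gen_mul /=; exact: eq_kapp.
Qed.

Lemma coef_Y k : coef k Y = k%:R^-1.
Proof.
rewrite -[Y]mulr1 -FMonom0 coef_gen_mul kapp_kletterS big_ord_recl coef_word
  mulrDr mulr1.
by rewrite big1 ?mulr0 ?addr0 // => j _; rewrite coef_word.
Qed.

Lemma eq_foldr_kapp s f g : f =1 g ->
  foldr (fun o => kapp (kletter o)) f s =1 foldr (fun o => kapp (kletter o)) g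
    s.
Proof. by move=> fg; elim: s => //= o s IH; exact: eq_kapp. Qed.

Definition coef_sum n (h : H) : R := \sum_(k < n) coef k h.

Lemma coef_sum_linear n c (g h : H) :
  coef_sum n (c *: g + h) = ratr c * coef_sum n g + coef_sum n h.
Proof.
by rewrite /coef_sum mulr_sumr -big_split; apply: eq_bigr => k _;
  exact: coef_linear.
Qed.

(** The matrix [kP] has rank one: the leading x supplies the row 1/k, the final y the column 1/j. *)
Lemma coef_sum_rotation n s m p :
  coef_sum n (X * gammaV << FMonom s >> * (Y ^+ m * gammaV << FMonom p >> * Y))
    =
  ktr n kP (kword (map Some s ++ nseq m None ++ map Some p)).
Proof.
apply: eq_bigr => -[k kn] _ /=; set t := _ ++ _.
rewrite -!mulrA coef_gen_mul kapp_kletterX.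
have -> : coef k (gammaV << FMonom s >> * (Y ^+ m * (gammaV << FMonom p >> *
  Y))) =
    kapp (kword t) (fun j => j%:R^-1) k.
  rewrite kapp_kword !foldr_cat coef_gammaV_word_mul; apply: eq_foldr_kapp => j.
  rewrite coef_Yexp_mul; apply: eq_foldr_kapp => i.
  rewrite coef_gammaV_word_mul; apply: eq_foldr_kapp => l; exact: coef_Y.
rewrite (kappE _ (@lower_kword t) kn).
by rewrite mulr_sumr; apply: eq_bigr => j _; rewrite /kP; ring.
Qed.

Lemma Zbar_linear c (g h : H) : Zbar R (c *: g + h) = ratr c * Zbar R g + Zbar
  R h.
Proof. exact: mmap_ratr_linear. Qed.

Lemma cvg_linear (u v : nat -> R) (a l m : R) :
  u n @[n --> \oo] --> l -> v n @[n --> \oo] --> m ->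
  a * u n + v n @[n --> \oo] --> a * l + m.
Proof. by move=> ul vm; apply: cvgD => //; exact: cvgMr. Qed.

Lemma Zbar_limit (g : H) :
  coef_sum n (X * g * Y) @[n --> \oo] --> Zbar R (X * g * Y).
Proof.
elim/malg_basis_ind: g => [c g1 g2 IH1 IH2||[s]].
- rewrite linear_mul2 Zbar_linear; under eq_fun do rewrite coef_sum_linear.
  exact: cvg_linear IH1 IH2.
- rewrite mulr0 mul0r /Zbar mmap0 /coef_sum.
  under eq_fun do under eq_bigr do rewrite coef0.
  under eq_fun do rewrite big1_eq.
  exact: cvg_cst.
have -> : X * << FMonom s >> * Y = << FMonom (lx :: rcons s ly) >>.
  rewrite !mulUU; congr (<< _ >>); apply/eqP.
  by rewrite fmP !(fmM, fmU) /= cats1.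
rewrite /Zbar mmap_ratr_word /coef_sum.
under eq_fun do under eq_bigr do rewrite coef_word.
exact: zeta_star_word_cvg.
Qed.

End Series.

(** * From [rhobar] to cyclic sums *)

Lemma FMonom_rcons (s : seq letter) c :
  << FMonom (rcons s c) >> = << FMonom s >> * gen c :> H.
Proof.
by rewrite mulUU; congr (<< _ >>); apply/eqP; rewrite fmP fmM fmU /= cats1.
Qed.

Lemma linZ (U V : lmodType rat) (f : U -> V) c v : linear f -> f (c *: v) = c
  *: f v.
Proof. by move=> fl; have := fl c v 0; rewrite (lin0 fl) !addr0. Qed.

Lemma Mmul_ldiam_linear n (b : H) : linear (fun t : Htensor n => Mmul (ldiam b
  t)).
Proof. by move=> c t t'; rewrite ldiam_linearr Mmul_linear. Qed.

Lemma Mmul_lrdiam_linear n (a b : H) :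
  linear (fun t : Htensor n => Mmul (ldiam b (rdiam t a))).
Proof. by move=> c t t'; rewrite rdiam_linearl; exact: Mmul_ldiam_linear. Qed.

Definition letter_sign (c : letter) : rat := if c == lx then 1 else -1.

Lemma Cbar_letterE n c : Cbar_letter n c = letter_sign c *: xyn n.
Proof. by rewrite /Cbar_letter /letter_sign; case: ifP;
  rewrite ?scaleN1r ?scale1r. Qed.

Lemma Mmul_diamD n (a b : H) (t : Htensor n.+1) c :
  Mmul (ldiam b (rdiam (c *: xyn n.+1) a + t)) =
  c *: (X * a * (Y ^+ n * b * Y)) + Mmul (ldiam b t).
Proof.
apply: (etrans (linD (Mmul_ldiam_linear b) _ t)); congr (_ + _).
apply: (etrans (linZ _ _ (Mmul_lrdiam_linear a b))); congr (_ *: _).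
exact: Mmul_xyn.
Qed.

(** One Leibniz step, matching the recursion of [cyclic_sum]: either [c] is removed, or it joins the
    prefix [p]. *)
Lemma Mmul_Cbar_cons n c s p :
  Mmul (ldiam (gammaV << FMonom p >>) (Cbar n.+1 << FMonom (c :: s) >>)) =
  letter_sign c *:
    (X * gammaV << FMonom s >> * (Y ^+ n * gammaV << FMonom p >> * Y))
  + Mmul (ldiam (gammaV << FMonom (rcons p c) >>) (Cbar n.+1 << FMonom s >>)).
Proof.
rewrite FMonom_rcons gammaVM ldiamM FMonom_cons Cbar_gen_mul Cbar_letterE.
exact: Mmul_diamD.
Qed.

Lemma Mmul_Cbar_nil n (b : H) : Mmul (ldiam b (Cbar n << FMonom [::] >>)) = 0.
Proof. by rewrite FMonom0 Cbar1 (lin0 (ldiam_linearr b)) (lin0 (@Mmul_linear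
  n)). Qed.

Lemma Mmul_Cbar_xHy n s p :
  exists g : H, Mmul (ldiam (gammaV << FMonom p >>) (Cbar n.+1 << FMonom s >>))
    = X * g * Y.
Proof.
elim: s p => [|c s IH] p.
  by exists 0; rewrite Mmul_Cbar_nil mulr0 mul0r.
have [g gE] := IH (rcons p c); rewrite Mmul_Cbar_cons gE.
move: (gammaV _) (Y ^+ n * _) => a q.
exists (letter_sign c *: (a * q) + g).
apply: (etrans _ (esym (linear_mul2 X Y _ (a * q) g))).
apply: (congr1 (fun t => _ *: t + _)).
exact: (etrans (mulrA (X * a) q Y) (congr1 ( *%R^~ Y) (esym (mulrA X a q)))).
Qed.

Lemma coef_sum_Mmul_Cbar (R : realType) N n s p :
  coef_sum R N (Mmul (ldiam (gammaV << FMonom p >>) (Cbar n.+1 << FMonom s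
    >>))) =
  cyclic_sum R N (nseq n None) (map Some p) (map Some s).
Proof.
elim: s p => [|c s IH] p /=.
  by rewrite Mmul_Cbar_nil /coef_sum big1 // => k _; exact: coef0.
rewrite Mmul_Cbar_cons coef_sum_linear IH coef_sum_rotation map_rcons.
by congr (_ * _ + _); rewrite /letter_sign /=; case: (c == lx);
  rewrite ?rmorphN rmorph1.
Qed.

Lemma rhobar_ker (R : realType) n (w : word) : (1 <= n)%N ->
  lx \in (w : seq letter) -> ly \in (w : seq letter) -> kerZbar R (rhobar n <<
    w >>).
Proof.
case: n => // n _; case: w => s xs ys.
have rhoE : rhobar n.+1 << FMonom s >> =
    Mmul (ldiam (gammaV << FMonom [::] >>) (Cbar n.+1 << FMonom s >>)).
  by rewrite FMonom0 gammaV1 ldiam1.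
have [g gE] := Mmul_Cbar_xHy n s [::].
have lim0 : null (fun N => coef_sum R N (X * g * Y)).
  apply: (@eq_null _ (fun N => cyclic_sum R N (nseq n None) [::] (map Some s)))
    => [N|].
    by rewrite -gE coef_sum_Mmul_Cbar.
  by apply: cyclic_sum_null; rewrite mem_map // => ? ? [].
rewrite rhoE gE; split.
  by exists 0, g; rewrite scale0r add0r.
rewrite -(cvg_lim (@Rhausdorff R) (@Zbar_limit R g)).
exact: (cvg_lim (@Rhausdorff R) lim0).
Qed.

(** * From words to the span *)

Lemma rhobar_linear n : linear (rhobar n).
Proof.
move=> c g h; rewrite /rhobar.
exact: (etrans (congr1 _ (Cbar_linear n c g h)) (Mmul_linear c _ _)).
Qed.

Lemma kerZbar_linear (R : realType) c (g h : H) :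
  kerZbar R g -> kerZbar R h -> kerZbar R (c *: g + h).
Proof.
move=> [[a [g' gE]] g0] [[b [h' hE]] h0]; split; last first.
  by rewrite Zbar_linear g0 h0 mulr0 addr0.
exists (c * a + b), (c *: g' + h').
rewrite linear_mul2 gE hE scalerDr scalerDl scalerA.
by rewrite [LHS]addrACA.
Qed.

Lemma kerZbar0 (R : realType) : kerZbar R 0.
Proof.
split; first by exists 0, 0; rewrite scale0r mulr0 mul0r addr0.
exact: mmap0.
Qed.

Lemma word_nseq (w : word) c : (~~ c) \notin (w : seq letter) ->
  << w >> = gen c ^+ size (w : seq letter) :> H.
Proof.
case: w => s /=; elim: s => [|d s IH]; first by rewrite FMonom0.
rewrite inE negb_or => /andP[dc /IH E]; rewrite FMonom_cons E exprS.
by congr (gen _ * _); case: c d dc {IH E} => -[].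
Qed.

Lemma X_expE_scalar r (c : rat) : X ^+ r = c%:A :> H -> r = 0%N.
Proof.
have XE : X ^+ r = << FMonom (nseq r lx) >>.
  by elim: r => [|r IH]; [rewrite FMonom0|rewrite exprS IH -FMonom_cons].
rewrite XE => /(congr1 (mcoeff (FMonom (nseq r lx)))).
rewrite mcoeffUU mcoeffZ -FMonom0 mcoeffU; case: eqP => [[]|_].
  by case: r {XE}.
by rewrite mulr0 => /eqP; rewrite oner_eq0.
Qed.

(** Without x the word is a power of y. Without y it is a power of x, and membership in [H1] forces
    it to be 1 = y^0. *)
Lemma H1check_word (w : word) : H1 << w >> -> (forall k : nat, << w >> <> Y ^+
  k) ->
  lx \in (w : seq letter) /\ ly \in (w : seq letter).
Proof.
move=> [c [g wE]] wY; split; apply/negPn/negP => nw.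
  by apply: (wY (size (w : seq letter))); exact: (@word_nseq w ly).
have wX : << w >> = X ^+ size (w : seq letter) by exact: (@word_nseq w lx).
have wc : << w >> = c%:A :> H.
  (* Sending y to 0 fixes a word without y and kills the part [g * Y]. *)
  transitivity (subst X 0 << w >>).
    rewrite substU word_prod; apply: eq_big_seq => -[] // dw.
    by rewrite dw in nw.
  rewrite wE (subst_linear X 0) subst1 substM.
  rewrite [subst X 0 Y]subst_gen mulr0 addr0; reflexivity.
have w0 := X_expE_scalar (etrans (esym wX) wc).
by apply: (wY 0%N); rewrite wX w0.
Qed.

Theorem corollary3p4 (R : realType) (n : nat) (hn : (1 <= n)%N) :
  rhobar n @` H1check `<=` kerZbar R.
Proof.
move=> _ [h [s [sP ->]] <-]; elim: s sP => [|p s IH] sP.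
  by rewrite big_nil (lin0 (@rhobar_linear n)); exact: kerZbar0.
rewrite big_cons rhobar_linear; apply: kerZbar_linear; last first.
  by apply: IH => q qs; apply: sP; rewrite inE qs orbT.
have [w [-> wH1 wY]] := sP p (mem_head p s).
have [xw yw] := H1check_word wH1 wY.
exact: rhobar_ker.
Qed.
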